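(* Let $n\ge 6$ be an integer and let $P_n=(V,\sigma,\mu)$ be a fuzzy path with $n$ vertices, represented as $P_n:u_1,u_2,\ldots,u_n$, of size $q$. Then $$\gamma_{snR}(P_n)\le\frac{2}{3}\left(q+\mu_{\min}+\mu_{\max}\right).$$
   Context: A fuzzy graph $G=(V,\sigma,\mu)$ consists of a finite nonempty set $V$, a function $\sigma:V\to[0,1]$, and a symmetric function $\mu:V\times V\to[0,1]$ with $\mu(x,x)=0$ and $\mu(x,y)\le \min\{\sigma(x),\sigma(y)\}$ for all $x,y\in V$. An edge is an unordered pair $(u,v)$ of distinct vertices with $\mu(u,v)>0$, and $\mu(u,v)$ is its weight. The size $q$ is the sum of the weights of all edges, each edge counted once. The strength of a path $x_0,x_1,\ldots,x_m$ (with every $\mu(x_{i-1},x_i)>0$) is $\min_i \mu(x_{i-1},x_i)$, and $CONN_G(u,v)$ is the maximum strength of all $u$–$v$ paths. An edge $(u,v)$ is strong if $\mu(u,v)=CONN_G(u,v)$; then $u,v$ are strong neighbors. $N_s(u)$ is the set of strong neighbors of $u$, and $\mu_s(u)=\min\{\mu(u,v):v\in N_s(u)\}$. $\mu_{\min}$ and $\mu_{\max}$ are the minimum and maximum weight of a strong edge. A fuzzy path $P_n:u_1,\ldots,u_n$ is a fuzzy graph with vertex set $V=\{u_1,\ldots,u_n\}$ ($n$ distinct vertices) whose edges are exactly $(u_i,u_{i+1})$ for $1\le i\le n-1$ (all of them are strong). A strong-neighbors Roman dominating function (SNRDF) on $G$ is a function $f:V\to\{0,1,2\}$ such that every $u$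 with $f(u)=0$ has some $v\in N_s(u)$ with $f(v)=2$. Its weight is $w(f)=\sum_{u\in V}f(u)\mu_s(u)$, and $\gamma_{snR}(G)$ is the minimum weight of an SNRDF on $G$. *)

(* Defs.v *)
From HB Require Import structures.
From mathcomp Require Import all_boot all_order all_algebra.
From mathcomp Require Import reals.
Set Implicit Arguments.
Unset Strict Implicit.
Unset Printing Implicit Defensive.
Import Order.TTheory GRing.Theory Num.Theory.
Local Open Scope ring_scope.

Record fuzzy_graph (R : realType) (V : finType) := FuzzyGraph {
  sigma : V -> R;
  mu : V -> V -> R;
  vertices_gt0 : (0 < #|V|)%N;
  sigma_itv : forall x, 0 <= sigma x <= 1;
  mu_itv : forall x y, 0 <= mu x y <= 1;
  mu_sym : forall x y, mu x y = mu y x;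
  mu_irr : forall x, mu x x = 0;
  mu_le_sigma : forall x y, mu x y <= Num.min (sigma x) (sigma y)
}.

Section FuzzyGraphTheory.
Variables (R : realType) (V : finType) (G : fuzzy_graph R V).

Definition edge : rel V := [rel u v | 0 < mu G u v].

(* The comparison of ranks selects one of the two orderings of each edge. *)
Definition fsize : R :=
  \sum_(e : V * V | (enum_rank e.1 < enum_rank e.2)%N && edge e.1 e.2)
    mu G e.1 e.2.

(* A path x_0, x_1, ..., x_m is given by x_0 and the sequence of the others. *)
Definition fpath_between (u v : V) (p : seq V) : bool :=
  [&& path edge u p, uniq (u :: p) & last u p == v].

(* As all weights are at most 1, the default 1 does not affect the minimum
   when m >= 1. *)
Definition strength (u : V) (p : seq V) : R :=
  \big[Num.min/1]_(w <- pairmap (mu G) u p) w.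

(* A path has distinct vertices, so its length is bounded by #|V|.  Strengths
   are positive; the value is 0 if no path joins u and v. *)
Definition conn (u v : V) : R :=
  \big[Num.max/0]_(p : {bseq #|V| of V} | fpath_between u v p) strength u p.

Definition strong_edge : rel V :=
  [rel u v | edge u v && (mu G u v == conn u v)].

Definition strong_nbrs (u : V) : {set V} := [set v | strong_edge u v].

(* The defaults of the next three extrema lie at the end of [0, 1] where they
   are absorbed as soon as the range is nonempty. *)
Definition mu_s (u : V) : R := \big[Num.min/1]_(v in strong_nbrs u) mu G u v.

Definition mu_min : R :=
  \big[Num.min/1]_(e : V * V | strong_edge e.1 e.2) mu G e.1 e.2.

Definition mu_max : R :=
  \big[Num.max/0]_(e : V * V | strong_edge e.1 e.2) mu G e.1 e.2.

Definition snrdf (f : {ffun V -> 'I_3}) : bool :=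
  [forall u, (f u == 0%N :> nat) ==>
     [exists v in strong_nbrs u, f v == 2%N :> nat]].

Definition rweight (f : {ffun V -> 'I_3}) : R := \sum_u (f u)%:R * mu_s u.

(* The constant function 1 is an SNRDF, so its weight is a harmless default. *)
Definition gamma_snR : R :=
  \big[Num.min/rweight [ffun=> inord 1]]_(f : {ffun V -> 'I_3} | snrdf f)
    rweight f.

Lemma snrdf_cst1 : snrdf [ffun=> inord 1].
Proof. by apply/forallP => u; rewrite ffunE inordK. Qed.

Lemma gamma_snR_le (f : {ffun V -> 'I_3}) : snrdf f -> gamma_snR <= rweight f.
Proof. by move=> sf; apply: bigmin_le_cond. Qed.

Lemma gamma_snR_attained : exists2 f, snrdf f & gamma_snR = rweight f.
Proof.
rewrite /gamma_snR; elim/big_rec: _ => [|f x sf [g sg ->]].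
  by exists [ffun=> inord 1]; first exact: snrdf_cst1.
by case: (leP (rweight f) (rweight g)) => _; [exists f|exists g].
Qed.

Definition is_fuzzy_path (n : nat) (u : 'I_n -> V) : Prop :=
  bijective u /\
  forall i j : 'I_n,
    edge (u i) (u j) = (j == i.+1 :> nat) || (i == j.+1 :> nat).

End FuzzyGraphTheory.

(* Main.v *)
Require Import Defs.
From mathcomp Require Import all_boot all_order all_algebra.
From mathcomp Require Import reals.
From mathcomp Require Import zify lra.
Import Order.TTheory GRing.Theory Num.Theory.
Local Open Scope ring_scope.

(** Number the vertices from 0 and let w_i be the weight of the i-th edge. For
    r < 3, put 2 on the vertices of index congruent to r modulo 3 and repair an
    undominated end vertex by putting 1 on it. Over the three functions each
    vertex receives 2 in total, plus 1 at each end, so the three weights sum to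
    2 (sum of mu_s) + w_first + w_last. As mu_s is the minimum of the two
    adjacent weights at an inner vertex, charging these minima away from the
    ends towards a lightest edge gives sum of mu_s <= q + mu_min. The lightest
    of the three functions then has the required weight. *)

(** Charge the [i]-th minimum to [w i.+1] if [i < k] and to [w i] otherwise: with the two end terms,
    each weight is used once and [w k] twice. The terms [w 0] and [w m] will account for the end
    vertices. *)
Lemma sum_min_consecutive (R : realDomainType) (w : nat -> R) (m k : nat) :
  (k <= m)%N ->
  \sum_(i < m) Num.min (w i) (w i.+1) + w 0%N + w m
    <= \sum_(i < m.+1) w i + w k.
Proof.
elim: m k => [|m IHm] k.
  by rewrite leqn0 => /eqP ->; rewrite big_ord0 big_ord1 add0r.
rewrite leq_eqVlt big_ord_recr [in leRHS]big_ord_recr /= => /predU1P[->|lt_km].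
  have := IHm m (leqnn m).
  have : Num.min (w m) (w m.+1) <= w m.+1 by rewrite ge_min lexx orbT.
  lra.
have := IHm k lt_km.
have : Num.min (w m) (w m.+1) <= w m by rewrite ge_min lexx.
lra.
Qed.

(** The left side does not mention [r], so the sum over unordered pairs is the same for every
    ranking. This lets [fsize] be computed in the order of the path. *)
Lemma sum_sym_ltn (R : numDomainType) (T : finType) (F : T -> T -> R)
    (r : T -> nat) :
  injective r -> (forall x y, F x y = F y x) -> (forall x, F x x = 0) ->
  \sum_x \sum_y F x y = (\sum_x \sum_(y | (r x < r y)%N) F x y) *+ 2.
Proof.
move=> r_inj Fsym Fxx; rewrite mulr2n.
rewrite [X in _ = _ + X](exchange_big_dep xpredT) //= -big_split /=.
apply: eq_bigr => x _; rewrite (bigD1 x) //= Fxx add0r.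
rewrite (bigID (fun y => (r x < r y)%N)) /=; congr (_ + _).
  by apply: eq_bigl => y; case: eqVneq => [->|]; rewrite ?ltnn ?andbT.
rewrite (eq_bigr (fun y => F y x)) => [|y _]; last exact: Fsym.
apply: eq_bigl => y; rewrite -leqNgt ltn_neqAle.
by rewrite (inj_eq r_inj).
Qed.

(** * Size, strength and strong edges in a fuzzy graph *)

Section FuzzyGraph.
Context (R : realType) (V : finType) (G : fuzzy_graph R V).

Lemma mu_ge0 x y : 0 <= mu G x y.
Proof. by have /andP[] := mu_itv G x y. Qed.

Lemma mu_le1 x y : mu G x y <= 1.
Proof. by have /andP[] := mu_itv G x y. Qed.

Lemma edgeE x y : edge G x y = (0 < mu G x y).
Proof. by []. Qed.

Lemma mu_nonedge x y : ~~ edge G x y -> mu G x y = 0.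
Proof. by rewrite edgeE lt_def mu_ge0 andbT negbK => /eqP. Qed.

Lemma fsize_ltn (r : V -> nat) : injective r ->
  fsize G = \sum_x \sum_(y | (r x < r y)%N) mu G x y.
Proof.
move=> r_inj; apply: (@mulIf _ 2%:R); first by rewrite pnatr_eq0.
rewrite !mulr_natr -(sum_sym_ltn _ _ _ _ r_inj); last 2 first.
- exact: mu_sym.
- exact: mu_irr.
rewrite (sum_sym_ltn _ _ _ (fun x : V => enum_rank x : nat)); last 3 first.
- by move=> x y /val_inj /enum_rank_inj.
- exact: mu_sym.
- exact: mu_irr.
congr (_ *+ 2); rewrite pair_big_dep /= /fsize big_mkcondr /=.
by apply: eq_bigr => -[x y] _ /=; case: ifPn => // /mu_nonedge ->.
Qed.

Lemma strong_edgeE x y :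
  strong_edge G x y = edge G x y && (mu G x y == conn G x y).
Proof. by []. Qed.

Lemma mu_le_conn x y : edge G x y -> mu G x y <= conn G x y.
Proof.
move=> xy; have sz : (size [:: y] <= #|V|)%N by apply: vertices_gt0 G.
have -> : mu G x y = strength G x (Bseq sz).
  by rewrite /strength /= big_seq1_id; apply/esym/min_idPl/mu_le1.
apply: le_bigmax_cond; rewrite /fpath_between /= eqxx xy !andbT inE.
by apply: contraTneq xy => <-; rewrite edgeE mu_irr ltxx.
Qed.

(** A path that starts in [S] and ends outside it has an edge leaving [S]. *)
Lemma strength_le_cut (S : pred V) (c : R) x p :
  S x -> ~~ S (last x p) ->
  (forall a b, S a -> ~~ S b -> mu G a b <= c) -> strength G x p <= c.
Proof.
move=> + + cut; elim: p x => [|y p IHp] x /= Sx; first by rewrite Sx.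
rewrite /strength /= big_cons -/(strength G y p) ge_min => Slast.
by case: (boolP (S y)) => Sy; [rewrite IHp ?orbT|rewrite cut].
Qed.

Lemma conn_le_cut (S : pred V) (c : R) x y :
  0 <= c -> S x -> ~~ S y ->
  (forall a b, S a -> ~~ S b -> mu G a b <= c) -> conn G x y <= c.
Proof.
move=> c_ge0 Sx Sy cut; apply: bigmax_le => // p /and3P[_ _ /eqP lastp].
by apply: strength_le_cut cut; rewrite ?lastp.
Qed.

Lemma mu_s_le x y : strong_edge G x y -> mu_s G x <= mu G x y.
Proof. by move=> xy; apply: bigmin_le_cond; rewrite inE. Qed.

Lemma mu_le_max x y : strong_edge G x y -> mu G x y <= mu_max G.
Proof. by move=> xy; apply: (@le_bigmax_cond _ _ _ _ (x, y)). Qed.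

End FuzzyGraph.

(** * Strong edges and size of a fuzzy path *)

Section FuzzyPath.
Context (R : realType) (V : finType) (P : fuzzy_graph R V) (m : nat).
Context (u : 'I_m.+2 -> V) (hP : is_fuzzy_path P u).

(** Indexing by [nat] allows [k.+1] without a bound proof; [v k] is meaningful for [k <= m.+1] and
    [w k] for [k <= m]. *)
Let v k : V := u (inord k).
Let w k : R := mu P (v k) (v k.+1).

(** Bijectivity lives in [Prop]; choice turns it into an inverse available as data. *)
Lemma path_rank : {g : V -> 'I_m.+2 | cancel u g & cancel g u}.
Proof.
have [/bij_inj u_inj _] := hP.
have u_surj x : exists i, u i == x.
  by have [[g _ gK] _] := hP; exists (g x); rewrite gK.
have gK : cancel (fun x => xchoose (u_surj x)) u.
  by move=> x; apply/eqP/(xchooseP (u_surj x)).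
by exists (fun x => xchoose (u_surj x)) => // i; apply: u_inj.
Qed.

Let g : V -> 'I_m.+2 := s2val path_rank.
Let uK : cancel u g := s2valP path_rank.
Let gK : cancel g u := s2valP' path_rank.

Let vK k : (k < m.+2)%N -> g (v k) = k :> nat.
Proof. by move=> lt_k; rewrite uK inordK. Qed.

Let gvK x : v (g x) = x.
Proof. by rewrite /v inord_val gK. Qed.

Lemma path_edge x y :
  edge P x y = (g y == (g x).+1 :> nat) || (g x == (g y).+1 :> nat).
Proof. by rewrite -{1}(gK x) -{1}(gK y) (proj2 hP). Qed.

(** Every edge is a bridge: it is the only one leaving the initial segment up to [x], or the final
    segment from [x], depending on its direction. [conn_le_cut] then bounds [conn] by its weight. *)
Lemma path_strong_edge x y : strong_edge P x y = edge P x y.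
Proof.
rewrite strong_edgeE; case: (boolP (edge P x y)) => // xy.
rewrite eq_le mu_le_conn // !andTb.
have muP (a b : V) : (g a = g x /\ g b = g y) \/ ~~ edge P a b ->
    mu P a b <= mu P x y.
  case=> [[/(can_inj gK) -> /(can_inj gK) ->] //|/mu_nonedge ->].
  exact: mu_ge0.
move: (xy); rewrite path_edge => /orP[] /eqP gxy.
  apply: (conn_le_cut _ _ _ (fun z => (g z <= g x)%N)); rewrite ?mu_ge0 //.
    by rewrite gxy ltnn.
  move=> a b ga gb; apply: muP; rewrite path_edge.
  case: (boolP ((g a == g x) && (g b == g y))) => [/andP[/eqP ? /eqP ?]|].
    by left.
  by rewrite -!val_eqE /= => ?; right; lia.
apply: (conn_le_cut _ _ _ (fun z => (g x <= g z)%N)); rewrite ?mu_ge0 //.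
  by rewrite gxy ltnn.
move=> a b ga gb; apply: muP; rewrite path_edge.
case: (boolP ((g a == g x) && (g b == g y))) => [/andP[/eqP ? /eqP ?]|].
  by left.
by rewrite -!val_eqE /= => ?; right; lia.
Qed.

Lemma path_strong k : (k < m.+1)%N -> strong_edge P (v k) (v k.+1).
Proof.
by move=> ltk; rewrite path_strong_edge path_edge !vK ?eqxx // ltnS ltnW.
Qed.

Lemma path_strong_sym k : (k < m.+1)%N -> strong_edge P (v k.+1) (v k).
Proof.
move=> ltk; rewrite path_strong_edge path_edge !vK ?eqxx ?orbT //.
by rewrite ltnS ltnW.
Qed.

Lemma sum_path_le_fsize : \sum_(i < m.+1) w i <= fsize P.
Proof.
rewrite (fsize_ltn _ _ P (fun x => g x : nat)); last first.
  by move=> x y /val_inj /(can_inj gK).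
rewrite (reindex u) /=; last by exists g => ? _ /=; rewrite ?uK ?gK.
rewrite [leRHS]big_ord_recr /= -[leLHS]addr0; apply: lerD; last first.
  by apply: sumr_ge0 => y _; apply: mu_ge0.
(* Keep only the successor in each inner sum; the other terms are nonnegative. *)
apply: ler_sum => i _; rewrite (bigD1 (v i.+1)) /=; last first.
  by rewrite uK vK /= ltnS.
have -> : u (widen_ord (leqnSn m.+1) i) = v i.
  by congr u; apply: val_inj; rewrite /= inordK // ltnS ltnW.
by rewrite lerDl; apply: sumr_ge0 => y _; apply: mu_ge0.
Qed.

Lemma path_mu_min : exists2 k, (k <= m)%N & w k <= mu_min P.
Proof.
have [k _ kmin] := @arg_minP _ R 'I_m.+1 ord0 xpredT (fun i => w i) isT.
exists (k : nat); first by rewrite -ltnS.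
apply: le_bigmin => [|[x y]]; first exact: mu_le1.
rewrite path_strong_edge path_edge /= => /orP[] /eqP gxy.
  have ltx : (g x < m.+1)%N by rewrite -ltnS -gxy.
  by have := kmin (Ordinal ltx) isT; rewrite /w /= -gxy !gvK.
have lty : (g y < m.+1)%N by rewrite -ltnS -gxy.
by have := kmin (Ordinal lty) isT; rewrite /w /= -gxy !gvK [in leRHS]mu_sym.
Qed.

(** * Bounding the sum of [mu_s] *)

Lemma path_mu_s_left : mu_s P (v 0) <= w 0.
Proof. exact/mu_s_le/path_strong. Qed.

Lemma path_mu_s_right : mu_s P (v m.+1) <= w m.
Proof. by rewrite /w mu_sym; apply/mu_s_le/path_strong_sym. Qed.

Lemma path_mu_s_inner k : (k < m)%N ->
  mu_s P (v k.+1) <= Num.min (w k) (w k.+1).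
Proof.
move=> ltk; rewrite le_min [X in _ <= X]mu_sym.
by rewrite !mu_s_le ?path_strong ?path_strong_sym // ltnW.
Qed.

Lemma sum_path_mu_s : \sum_(i < m.+2) mu_s P (v i) <= fsize P + mu_min P.
Proof.
have [k lekm wk] := path_mu_min.
have := sum_min_consecutive _ w _ _ lekm.
have := sum_path_le_fsize.
have -> : \sum_(i < m.+2) mu_s P (v i)
    = mu_s P (v 0) + (\sum_(i < m) mu_s P (v i.+1) + mu_s P (v m.+1)).
  by rewrite big_ord_recl big_ord_recr.
have : \sum_(i < m) mu_s P (v i.+1) <= \sum_(i < m) Num.min (w i) (w i.+1).
  by apply: ler_sum => i _; apply: path_mu_s_inner.
have := path_mu_s_left; have := path_mu_s_right; lra.
Qed.

(** The boolean counts as the repair value 1. Vertex 0 is undominated when neither 0 nor 1 has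
    residue [r], so when [r] is 2; vertex [m.+1] when neither [m] nor [m.+1] has, so when [m.+2]
    does. *)
Definition roman_value (r k : nat) : nat :=
  (if k %% 3 == r then 2
   else ((k == 0) && (r == 2)) || ((k == m.+1) && (m.+2 %% 3 == r)))%N.

Definition roman_fun (r : nat) : {ffun V -> 'I_3} :=
  [ffun x => inord (roman_value r (g x))].

Lemma roman_funE r x : roman_fun r x = roman_value r (g x) :> nat.
Proof.
by rewrite ffunE inordK // /roman_value; case: ifP => // _; case: (_ || _).
Qed.

Lemma snrdf_roman_fun r : (r < 3)%N -> snrdf P (roman_fun r).
Proof.
move=> lt_r3; apply/forallP => x; apply/implyP; rewrite roman_funE => /eqP fx.
have [k lt_k /andP[kP kr]] : exists2 k, (k < m.+2)%N &
    ((k == (g x).+1) || (g x == k.+1 :> nat)) && (k %% 3 == r)%N.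
  have := ltn_ord (g x); move: fx; rewrite /roman_value.
  case: ifP => // /eqP gr /eqP; rewrite eqb0 => ends ltg.
  (* One of the two indices adjacent to [g x] has residue [r]. It is in range, since otherwise [x]
     would be a repaired end. *)
  have [e|ne] := eqVneq ((g x).+1 %% 3)%N r.
    by exists (g x).+1; lia.
  by exists (g x).-1; lia.
apply/existsP; exists (v k); rewrite inE path_strong_edge path_edge vK //.
by rewrite kP roman_funE vK // /roman_value kr.
Qed.

(** Each index has one residue, and each end is repaired for exactly one [r], different from its own
    residue. *)
Lemma sum_roman_value k :
  (roman_value 0 k + roman_value 1 k + roman_value 2 k
    = 2 + (k == 0) + (k == m.+1))%N.
Proof.
rewrite /roman_value; case: (k =P 0%N) => [->|k_neq0] /=; first by lia.
by case: (k =P m.+1) => [->|_] /=; do ?case: eqP => ? /=; lia.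
Qed.

Lemma sum_rweight_roman :
  rweight P (roman_fun 0) + rweight P (roman_fun 1) + rweight P (roman_fun 2)
  = 2%:R * (\sum_(i < m.+2) mu_s P (v i)) + mu_s P (v 0) + mu_s P (v m.+1).
Proof.
have rweightE r : rweight P (roman_fun r)
    = \sum_(i < m.+2) (roman_value r i)%:R * mu_s P (v i).
  rewrite /rweight (reindex u) /=; last by exists g => ? _ /=; rewrite ?uK ?gK.
  by apply: eq_bigr => i _; rewrite roman_funE uK /v inord_val.
rewrite !rweightE -!big_split /=.
under eq_bigr => i _ do
  rewrite -!mulrDl -!natrD sum_roman_value natrD (natrD _ 2) 2!mulrDl.
rewrite !big_split /= -mulr_sumr; congr (_ + _ + _).
  rewrite big_ord_recl /= mul1r big1 ?addr0 // => i _.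
  by rewrite mul0r.
rewrite big_ord_recr /= eqxx mul1r big1 ?add0r // => i _.
by rewrite ltn_eqF ?mul0r.
Qed.

Lemma path_gamma_snR :
  gamma_snR P <= 2%:R / 3%:R * (fsize P + mu_min P + mu_max P).
Proof.
have := gamma_snR_le (snrdf_roman_fun 0 isT).
have := gamma_snR_le (snrdf_roman_fun 1 isT).
have := gamma_snR_le (snrdf_roman_fun 2 isT).
have := sum_rweight_roman; have := sum_path_mu_s.
have := path_mu_s_left; have := path_mu_s_right.
have : w 0 <= mu_max P by apply/mu_le_max/path_strong.
have : w m <= mu_max P by apply/mu_le_max/path_strong.
(* Adding the three bounds gives three times [gamma_snR P] on the left; the two end weights are at
   most [mu_max P] each. *)
lra.
Qed.

End FuzzyPath.

Theorem theorem4p6 (R : realType) (n : nat) (hn : (6 <= n)%N) (V : finType)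
    (P : fuzzy_graph R V) (u : 'I_n -> V) (hP : is_fuzzy_path P u) :
  gamma_snR P <= 2%:R / 3%:R * (fsize P + mu_min P + mu_max P).
Proof.
case: n hn u hP => [|[|m]] // _ u hP.
exact: path_gamma_snR hP.
Qed.
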